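(* There exists an absolute constant $\varepsilon > 0$ such that for all positive integers $k$ and $\ell$ satisfying $0 < \ell < \binom{k}{2}$ we have $$\mathrm{ind}(k,\ell) < 1 - \varepsilon.$$
   Context: All graphs are finite and simple. For a positive integer $k$ and a graph $G$ with at least $k$ vertices, let $A = A_{G,k}$ be chosen uniformly at random from all $k$-element subsets of $V(G)$, and let $X_{G,k} = e(G[A])$ be the number of edges of $G$ with both endpoints in $A$. For integers $n \ge k$ and $0 \le \ell \le \binom{k}{2}$ let $I(n,k,\ell) = \max\{\mathbb{P}(X_{G,k} = \ell) : G \text{ is a graph on } n \text{ vertices}\}$. For fixed $k,\ell$ the sequence $I(n,k,\ell)$ is non-increasing in $n$, and the edge-inducibility is defined by $\mathrm{ind}(k,\ell) := \lim_{n\to\infty} I(n,k,\ell)$. *)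

(* Defs.v *)
From HB Require Import structures.
From mathcomp Require Import all_boot all_order all_algebra.
From mathcomp Require Import all_classical all_reals all_analysis.

Set Implicit Arguments.
Unset Strict Implicit.
Unset Printing Implicit Defensive.

Import Order.TTheory GRing.Theory Num.Theory.
Import numFieldNormedType.Exports.

Local Open Scope classical_set_scope.
Local Open Scope ring_scope.

(* A finite simple graph on the vertex set V, given by its edge set: a set of
   two-element subsets of V. *)
Definition sgraph (V : finType) : finType :=
  {E : {set {set V}} | [forall e in E, #|e| == 2%N]}.

Definition edges (V : finType) (G : sgraph V) : {set {set V}} := val G.

Definition induced_edges (V : finType) (G : sgraph V) (A : {set V}) : nat :=
  #|[set e in edges G | e \subset A]%SET|.

Definition ksubsets (V : finType) (k : nat) : {set {set V}} :=
  [set A : {set V} | #|A| == k]%SET.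

(* P(X_{G,k} = l) for the uniform distribution on k-subsets of V.  It is only
   meaningful for k <= #|V|; otherwise the quotient is 0 / 0 = 0. *)
Definition edge_prob (R : realType) (V : finType) (G : sgraph V) (k l : nat)
    : R :=
  #|[set A in ksubsets V k | induced_edges G A == l]%SET|%:R
    / #|ksubsets V k|%:R.

(* I(n,k,l).  The default value 0 of the maximum is harmless, since
   probabilities are nonnegative and there is always a graph on n vertices. *)
Definition max_edge_prob (R : realType) (n k l : nat) : R :=
  \big[Num.max/0]_(G : sgraph 'I_n) edge_prob R G k l.

(* ind(k,l).  The terms with n < k are junk (equal to 0) but do not affect the
   limit. *)
Definition edge_inducibility (R : realType) (k l : nat) : R :=
  limn (fun n : nat => max_edge_prob R n k l).

(* Main.v *)
(* Restrict the graph to a random set S of 2k vertices: it is enough to show that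
   at least 1/32 of the k-subsets A of S do not span exactly l edges (call these
   bad). Suppose that few are bad.  Exchanging u in A for u' outside A does not
   change the number of edges for most A, and likewise for the complement of A in
   S; hence u and u' have the same degree in S, for every u and most u', and so
   the graph on S is regular.  Exchanging two vertices u, v for u', v' shows that
   uv + u'v' = uv' + u'v (as 0/1 adjacencies) for every pair u, v and most pairs
   u', v'.  If S has degree less than k this fails for an edge uv, as u' can be
   taken nonadjacent to v and v' nonadjacent to u; otherwise it fails for a
   nonadjacent pair.  So S is empty or complete, and all its k-subsets are bad. *)
Require Import Defs.
From mathcomp Require Import all_boot all_order all_algebra.
From mathcomp Require Import all_classical all_reals all_analysis.
From mathcomp Require Import fintype finset zify lra.

Set Implicit Arguments.
Unset Strict Implicit.
Unset Printing Implicit Defensive.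

Import Order.TTheory GRing.Theory Num.Theory.
Import numFieldNormedType.Exports.

Local Open Scope nat_scope.

(** * Adjacency, degrees, and bad sets forced by exchanging vertices *)

Definition adj (V : finType) (G : sgraph V) : rel V :=
  fun x y => [set x; y] \in edges G.

Definition degree (V : finType) (G : sgraph V) (A : {set V}) (x : V) : nat :=
  #|[set y in A | adj G x y]|.

Definition bad_sets (V : finType) (G : sgraph V) (S : {set V}) (k l : nat)
    : {set {set V}} :=
  [set A : {set V} | [&& A \subset S, #|A| == k & induced_edges G A != l]].

(** A bad set obtained by exchanging [u] and [v] contains exactly one of them, so it is charged only
    to pairs that it separates. *)
Definition separates (V : finType) (A : {set V}) (u v : V) : bool :=
  (u \in A) (+) (v \in A).

Lemma card_edge (V : finType) (G : sgraph V) e : e \in edges G -> #|e| = 2.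
Proof. by move=> eG; apply/eqP; have /forall_inP := valP G; apply. Qed.

Lemma adjC (V : finType) (G : sgraph V) x y : adj G x y = adj G y x.
Proof. by rewrite /adj setUC. Qed.

Lemma adjxx (V : finType) (G : sgraph V) x : adj G x x = false.
Proof. by apply/negP => /card_edge; rewrite setUid cards1. Qed.

Lemma degreeU1 (V : finType) (G : sgraph V) (A : {set V}) x u :
  u \notin A -> degree G (u |: A) x = degree G A x + adj G x u.
Proof.
move=> uA; rewrite /degree; case: (boolP (adj G x u)) => xu.
  have -> : [set y in u |: A | adj G x y] = u |: [set y in A | adj G x y].
    by apply/setP => y; rewrite !inE; case: eqVneq => // ->.
  by rewrite cardsU1 inE (negPf uA) addnC.
rewrite addn0; apply: eq_card => y; rewrite !inE.
by case: eqVneq => // ->; rewrite (negPf uA) (negPf xu).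
Qed.

Lemma induced_edgesU1 (V : finType) (G : sgraph V) (A : {set V}) u :
  u \notin A -> induced_edges G (u |: A) = induced_edges G A + degree G A u.
Proof.
move=> uA; rewrite /induced_edges /degree.
(* The new edges are the images of the neighbours [y] of [u] in [A] under the injection sending [y]
   to [{u, y}]. *)
rewrite -(card_in_imset (f := fun y => [set u; y])); last first.
  move=> y z; rewrite !inE => /andP[yA _] /andP[zA _] /setP /(_ y).
  rewrite !inE eqxx orbT; case: eqVneq => [yu|_ /esym/eqP //].
  by rewrite -yu yA in uA.
rewrite -cardsUI [X in _ = _ + X]eq_card0 ?addn0; last first.
  move=> e; rewrite !inE; apply/negP => /andP[/andP[_ eA] /imsetP[y _ ee]].
  by move: (subsetP eA u); rewrite ee !inE eqxx (negPf uA) => /(_ isT).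
apply: eq_card => e; rewrite !inE.
apply/andP/orP => [[eG eA]|[/andP[eG eA]|/imsetP[y yA ->]]].
- have [ue|ue] := boolP (u \in e); last first.
    left; rewrite eG /=; apply/subsetP => y ye.
    move: (subsetP eA y ye); rewrite !inE => /predU1P[yu|//].
    by rewrite -yu ye in ue.
  right; have /eqP/cards2P[a [b [ab eE]]] := card_edge eG.
  move: ue eG eA ab; rewrite eE !inE => /orP[] /eqP<- eG /subsetP eA ab.
    apply/imsetP; exists b => //; rewrite inE /adj eG andbT.
    by move: (eA b); rewrite !inE eqxx orbT => /(_ isT)/predU1P[bu|//]; rewrite bu eqxx in ab.
  rewrite setUC; apply/imsetP; exists a => //.
  rewrite inE /adj [X in X \in edges G]setUC eG andbT.
  by move: (eA a); rewrite !inE eqxx => /(_ isT)/predU1P[bu|//]; rewrite bu eqxx in ab.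
- by split=> //; rewrite (subset_trans eA) // subsetUr.
move: yA; rewrite inE => /andP[yA uy]; split=> //.
by rewrite subUset !sub1set !inE eqxx yA orbT.
Qed.

Lemma degree_split (V : finType) (G : sgraph V) (A W : {set V}) x :
  A \subset W -> degree G W x = degree G A x + degree G (W :\: A) x.
Proof.
move=> AW; rewrite /degree -(cardsID A); congr (_ + _); apply: eq_card => y.
  rewrite !inE; case: (boolP (y \in A)) => yA; rewrite ?andbF //.
  by rewrite (subsetP AW) ?andbT.
by rewrite !inE andbA.
Qed.

(* Exchanging u and u' in a good set shows that they have the same degree into
   the rest of it; doing this both for a set and for its complement in S, one
   gets that u and u' have the same degree in S. *)
Lemma card_bad_degree (V : finType) (G : sgraph V) (S : {set V}) m l u u' :
  #|S| = m.+1.*2 -> u \in S -> u' \in S -> degree G S u != degree G S u' ->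
  'C(m.*2, m) <= 2 * #|[set A in bad_sets G S m.+1 l | separates A u u']|.
Proof.
move=> cS uS u'S; set F := [set A in _ | _] => dd.
have uu' : u != u' by apply: contraNneq dd => ->.
set W := S :\: [set u; u'].
have SW : S = u |: (u' |: W).
  apply/setP => x; rewrite !inE; case: eqVneq => [->|xu]; first exact: uS.
  by case: eqVneq => [->|].
have uW : u \notin W by rewrite !inE eqxx.
have u'W : u' \notin W by rewrite !inE eqxx orbT.
have uU : u \notin u' |: W by rewrite !inE negb_or uu' eqxx.
have cW : #|W| = m.*2.
  by move: cS; rewrite SW cardsU1 uU cardsU1 u'W /=; lia.
rewrite -cW -cards_draws; set D := [set A | _ & _].
(* Each [A] in [D] gives a bad set among [x |: A] and [x |: (W :\: A)] with [x] equal to [u] or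
   [u']; [f1] recovers [A] from the first form and [f2] from the second. The two maps account for
   the factor 2. *)
pose f1 A := A :\: [set u; u']; pose f2 A := S :\: A :\: [set u; u'].
suff DF : D \subset f1 @: F :|: f2 @: F.
  apply: leq_trans (subset_leq_card DF) _; rewrite cardsU mul2n -addnn.
  by apply: leq_trans (leq_subr _ _) _; apply: leq_add; apply: leq_imset_card.
have inF x A : x \in [set u; u'] -> A \in D -> induced_edges G (x |: A) != l ->
    x |: A \in F.
  move=> xu; rewrite inE => /andP[AW cA] bad; rewrite !inE bad andbT.
  have xA : x \notin A.
    by apply: contraTN xu => /(subsetP AW); rewrite inE => /andP[].
  rewrite cardsU1 xA (eqP cA) eqxx andbT subUset sub1set; apply/andP; split.
    rewrite (subset_trans AW) ?subsetDl // andbT.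
    by move: xu; rewrite !inE => /orP[]/eqP->.
  have uA : u \notin A by apply: contraNN uW; apply: (subsetP AW).
  have u'A : u' \notin A by apply: contraNN u'W; apply: (subsetP AW).
  move: xu; rewrite /separates !inE (negPf uA) (negPf u'A) !orbF.
  by case/orP => /eqP ->; rewrite eqxx ?(negPf uu') // eq_sym (negPf uu').
apply/subsetP => A AD; apply: contraR dd; rewrite inE negb_or => /andP[Af1 Af2].
have AW : A \subset W by move: AD; rewrite inE => /andP[].
have BD : W :\: A \in D.
  move: AD; rewrite !inE => /andP[_ /eqP cA]; rewrite subsetDl /=.
  by have := cardsID A W; rewrite (setIidPr AW); lia.
have good1 x : x \in [set u; u'] -> induced_edges G (x |: A) = l.
  move=> xu; apply/eqP; apply: contraR Af1 => /(inF x A xu AD) xF.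
  apply/imsetP; exists (x |: A) => //; apply/setP => y.
  rewrite in_setD [y \in x |: A]in_setU1.
  case: (boolP (y \in [set u; u'])) => yu /=.
    by apply/negP => /(subsetP AW); rewrite in_setD yu.
  by case: eqVneq => [yx|_ //]; rewrite yx xu in yu.
have good2 x : x \in [set u; u'] -> induced_edges G (x |: (W :\: A)) = l.
  move=> xu; apply/eqP; apply: contraR Af2 => /(inF x _ xu BD) xF.
  apply/imsetP; exists (x |: (W :\: A)) => //; apply/setP => y.
  rewrite 2!in_setD [y \in x |: _]in_setU1 2!in_setD.
  case: (boolP (y \in [set u; u'])) => yu /=.
    by apply/negP => /(subsetP AW); rewrite in_setD yu.
  case: eqVneq => [yx|_]; first by rewrite yx xu in yu.
  case: (boolP (y \in A)) => yA /=; last by case: (y \in S).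
  by have := subsetP AW _ yA; rewrite inE => /andP[_ ->].
have eqdeg (A0 : {set V}) : A0 \subset W ->
    induced_edges G (u |: A0) = induced_edges G (u' |: A0) ->
    degree G A0 u = degree G A0 u'.
  move=> /subsetP A0W; rewrite !induced_edgesU1; first exact: addnI.
    exact: contraNN (A0W _) u'W.
  exact: contraNN (A0W _) uW.
have e1 : degree G A u = degree G A u'.
  by apply: eqdeg => //; rewrite !good1 // !inE eqxx ?orbT.
have e2 : degree G (W :\: A) u = degree G (W :\: A) u'.
  by apply: eqdeg; rewrite ?subsetDl // !good2 // !inE eqxx ?orbT.
(* Outside [A] and [W :\: A], only the adjacency of [u] and [u'] contributes, and it is
   symmetric. *)
rewrite SW !degreeU1 // !(degree_split _ _ AW) e1 e2 !adjxx [adj G u' u]adjC.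
by rewrite !addn0.
Qed.

(* For a good choice of the other vertices, the numbers of edges spanned together
   with one of u, u' and one of v, v' are all equal, so that their mixed second
   difference vanishes. *)
Lemma card_bad_adj (V : finType) (G : sgraph V) (S : {set V}) m l u u' v v' :
  #|S| = m.+2.*2 -> uniq [:: u; u'; v; v'] -> {subset [:: u; u'; v; v'] <= S} ->
  adj G u v + adj G u' v' != adj G u v' + adj G u' v ->
  'C(m.*2, m) <= #|[set A in bad_sets G S m.+2 l |
                     separates A u u' && separates A v v']|.
Proof.
move=> cS un sub; set F := [set A in _ | _] => dd.
pose Q := [set x in [:: u; u'; v; v']]; set W := S :\: Q.
have cW : #|W| = m.*2.
  have QS : Q \subset S by apply/subsetP => x; rewrite inE; apply: sub.
  have cQ : #|Q| = 4 by rewrite cardsE (card_uniqP un).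
  by have := cardsID Q S; rewrite (setIidPr QS) cS cQ -/W; lia.
rewrite -cW -cards_draws; set D := [set A | _ & _].
pose f A := A :\: Q.
suff DF : D \subset f @: F.
  exact: leq_trans (subset_leq_card DF) (leq_imset_card _ _).
apply/subsetP => A; rewrite inE => /andP[AW /eqP cA]; apply: contraR dd => Af.
have AQ x : x \in Q -> x \notin A.
  by move=> xQ; apply/negP => /(subsetP AW); rewrite inE xQ.
move: (un) => /=; rewrite !inE !negb_or => /and4P[/and3P[uu' uv uv'] /andP[u'v u'v'] vv' _].
have [uQ u'Q vQ v'Q] : [/\ u \in Q, u' \in Q, v \in Q & v' \in Q].
  by split; rewrite !inE eqxx ?orbT.
have good x y : x \in [:: u; u'] -> y \in [:: v; v'] ->
    induced_edges G A + degree G A y + (degree G A x + adj G x y) = l.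
  move=> xu yv.
  have xQ : x \in Q by move: xu; rewrite !inE => /orP[]->; rewrite ?orbT.
  have yQ : y \in Q by move: yv; rewrite !inE => /orP[]->; rewrite ?orbT.
  have xy : x != y.
    by move: xu yv; rewrite !inE => /orP[]/eqP-> /orP[]/eqP->.
  have xyA : x \notin y |: A by rewrite !inE negb_or xy AQ.
  rewrite -degreeU1 ?AQ // -induced_edgesU1 ?AQ // -induced_edgesU1 //.
  apply/eqP; apply: contraR Af => bad; apply/imsetP; exists (x |: (y |: A)).
    rewrite !inE bad !cardsU1 xyA AQ // cA eqxx !subUset !sub1set.
    rewrite (subset_trans AW (subsetDl _ _)) !sub ?inE; last 2 first.
    - by move: yQ; rewrite !inE.
    - by move: xQ; rewrite !inE.
    rewrite /separates !inE !(negPf (AQ _ _)) // !orbF.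
    move: xu yv; rewrite !inE.
    by case/orP => /eqP-> /orP[]/eqP->; rewrite !eqxx;
       rewrite ?(eq_sym u' u) ?(eq_sym v' v) ?(eq_sym v u) ?(eq_sym v u') ?(eq_sym v' u)
         ?(eq_sym v' u') ?(negPf uu') ?(negPf uv) ?(negPf uv') ?(negPf u'v) ?(negPf u'v')
         ?(negPf vv').
  apply/setP => z; rewrite in_setD !in_setU1.
  case: (boolP (z \in Q)) => zQ /=; first by rewrite (negPf (AQ _ zQ)).
  case: eqVneq => [zx|_]; first by rewrite zx xQ in zQ.
  by case: eqVneq => [zy|_ //]; rewrite zy yQ in zQ.
have := good u v; have := good u v'; have := good u' v; have := good u' v'.
rewrite !inE !eqxx ?orbT => /(_ isT isT) a /(_ isT isT) b /(_ isT isT) c /(_ isT isT) d.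
by apply/eqP; clear -a b c d; lia.
Qed.

(** * Central binomials and double counting of separated pairs *)

(** The ratio of the two binomials is 2(2m+1)/(m+1), which is less than 4. *)
Lemma bin_central_step m : 'C(m.+1.*2, m.+1) <= 4 * 'C(m.*2, m).
Proof.
have := mul_bin_diag m.+1.*2 m; have := mul_bin_down m.*2.+1 m.
rewrite doubleS /= -addnn subSn ?leq_addr // addnK addnn => e1 e2.
by rewrite -(leq_pmul2l (ltn0Sn m)); nia.
Qed.

(** The vertices separated from [u] form [A] or its complement in [S], whichever misses [u]; both
    have size [k] because [S] has size 2k. *)
Lemma card_separated (V : finType) (S A : {set V}) k u :
  #|S| = k.*2 -> A \subset S -> #|A| = k ->
  #|[set x in S | separates A u x]| = k.
Proof.
move=> cS AS cA; have [uA|uA] := boolP (u \in A); rewrite /separates.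
  have <- : #|S :\: A| = k by have := cardsID A S; rewrite (setIidPr AS); lia.
  by apply: eq_card => x; rewrite !inE uA /= andbC.
rewrite -cA; apply: eq_card => x; rewrite !inE (negPf uA) /=.
by case: (boolP (x \in A)) => [/(subsetP AS) ->|]; rewrite ?andbF.
Qed.

Lemma sum_separates_le (V : finType) (S A P : {set V}) k u :
  #|S| = k.*2 -> A \subset S -> #|A| = k -> P \subset S ->
  \sum_(x in P) separates A u x <= k.
Proof.
move=> cS AS cA PS; rewrite -[leqRHS](card_separated u cS AS cA) -sum1_card.
rewrite big_mkcond [leqRHS]big_mkcond; apply: leq_sum => x _; rewrite inE.
case: (boolP (x \in P)) => // /(subsetP PS) -> /=.
by case: separates.
Qed.

Lemma card_set_sum (T : finType) (B : {set T}) (p : pred T) :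
  #|[set x in B | p x]| = \sum_(x in B) p x.
Proof.
rewrite -sum1_card big_mkcond [RHS]big_mkcond; apply: eq_bigr => x _.
by rewrite inE; case: (x \in B) => //; case: (p x).
Qed.

Lemma sum_bad_separates (V : finType) (G : sgraph V) (S P : {set V}) k l u :
  #|S| = k.*2 -> P \subset S ->
  \sum_(x in P) #|[set A in bad_sets G S k l | separates A u x]|
    <= k * #|bad_sets G S k l|.
Proof.
move=> cS PS; under eq_bigr do rewrite card_set_sum.
rewrite exchange_big mulnC -sum_nat_const; apply: leq_sum => A.
by rewrite inE => /and3P[AS /eqP cA _]; apply: sum_separates_le cS _ _ _.
Qed.

(** For a fixed bad set the indicator of the conjunction is a product, so the double sum factors
    into two sums, each at most [k]. *)
Lemma sum_bad_separates2 (V : finType) (G : sgraph V) (S P Q : {set V}) k l u v :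
  #|S| = k.*2 -> P \subset S -> Q \subset S ->
  \sum_(x in P) \sum_(y in Q)
      #|[set A in bad_sets G S k l | separates A u x && separates A v y]|
    <= k * k * #|bad_sets G S k l|.
Proof.
move=> cS PS QS; rewrite (eq_bigr (fun x => \sum_(A in bad_sets G S k l)
    separates A u x * \sum_(y in Q) separates A v y)); last first.
  move=> x _; under eq_bigr do rewrite card_set_sum.
  rewrite exchange_big; apply: eq_bigr => A _; rewrite big_distrr /=.
  by apply: eq_bigr => y _; rewrite mulnb.
rewrite exchange_big mulnC -sum_nat_const; apply: leq_sum => A.
rewrite inE => /and3P[AS /eqP cA _]; rewrite -big_distrl /=.
by apply: leq_mul; apply: sum_separates_le cS _ _ _.
Qed.

(** * Few bad sets: regularity, then a contradiction at an edge or a non-edge *)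

(** If [u] and [v] had different degrees, every vertex of [S] would differ in degree from one of
    them, so [X u] and [X v] would have at least 2(m+1) elements in total. Each element forces at
    least half of ['C(m.*2, m)] bad sets, and each bad set is counted at most m+1 times for [u] and
    for [v]. *)
Lemma degree_constant (V : finType) (G : sgraph V) (S : {set V}) m l :
  #|S| = m.+1.*2 -> 2 * #|bad_sets G S m.+1 l| < 'C(m.*2, m) ->
  {in S &, forall u v, degree G S u = degree G S v}.
Proof.
move=> cS few u v uS vS; apply/eqP; apply: contraTT few => uv; rewrite -leqNgt.
pose X w := [set x in S | degree G S w != degree G S x].
have cX w : w \in S ->
    #|X w| * 'C(m.*2, m) <= 2 * (m.+1 * #|bad_sets G S m.+1 l|).
  move=> wS; apply: leq_trans (leq_mul (leqnn 2) (sum_bad_separates G l w cS _)).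
    rewrite -sum_nat_const big_distrr /=; apply: leq_sum => x.
    by rewrite inE => /andP[xS]; apply: card_bad_degree.
  by apply/subsetP => x; rewrite inE => /andP[].
have SX : S \subset X u :|: X v.
  apply/subsetP => x xS; rewrite !inE xS /=.
  by have [<-|//] := eqVneq (degree G S u); rewrite eq_sym.
have := leq_trans (subset_leq_card SX) (leq_card_setU _ _); rewrite cS => le.
have := cX u uS; have := cX v vS; move: le.
move: #|X u| #|X v| 'C(_, _) #|bad_sets _ _ _ _| => a b c d {cX SX}.
move=> ab bc ac; rewrite -(leq_pmul2l (ltn0Sn m)).
have : (a + b) * c <= 4 * (m.+1 * d) by rewrite mulnDl; lia.
have : m.+1.*2 * c <= (a + b) * c by rewrite leq_mul2r ab orbT.
nia.
Qed.

(** There are at least (m+2)(m+1) pairs of distinct [x] in [P] and [y] in [Q], each forcing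
    ['C(m.*2, m)] bad sets, while a bad set is counted at most (m+2)^2 times. The factor 2 comes
    from m+2 <= 2(m+1). *)
Lemma card_bad_adj_sum (V : finType) (G : sgraph V) (S P Q : {set V}) m l u v :
  #|S| = m.+2.*2 -> u != v -> u \in S -> v \in S ->
  P \subset S :\: [set u; v] -> Q \subset S :\: [set u; v] ->
  m.+2 <= #|P| -> m.+2 <= #|Q| ->
  (forall x y, x \in P -> y \in Q -> x != y ->
     adj G u v + adj G x y != adj G u y + adj G x v) ->
  'C(m.*2, m) <= 2 * #|bad_sets G S m.+2 l|.
Proof.
move=> cS uv uS vS PS QS cP cQ dd.
have inS x : x \in S :\: [set u; v] -> [/\ x \in S, x != u & x != v].
  by rewrite !inE negb_or => /andP[/andP[]].
have sub (R : {set V}) : R \subset S :\: [set u; v] -> R \subset S.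
  by move=> RS; apply: subset_trans RS (subsetDl _ _).
have := sum_bad_separates2 G l u v cS (sub P PS) (sub Q QS).
have : #|P| * (m.+1 * 'C(m.*2, m)) <= \sum_(x in P) \sum_(y in Q)
    #|[set A in bad_sets G S m.+2 l | separates A u x && separates A v y]|.
  rewrite -sum_nat_const; apply: leq_sum => x xP.
  have [xS xu xv] := inS x (subsetP PS x xP).
  apply: (@leq_trans (#|Q :\ x| * 'C(m.*2, m))).
    by rewrite leq_mul2r; have := cardsD1 x Q; case: (x \in Q); lia.
  rewrite -sum_nat_const big_mkcond [leqRHS]big_mkcond; apply: leq_sum => y _.
  rewrite in_setD1; case: (boolP (y \in Q)) => yQ; rewrite ?andbF ?andbT //.
  have [//|yx] := eqVneq y x; have [yS yu yv] := inS y (subsetP QS y yQ).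
  apply: card_bad_adj cS _ _ _.
  - by rewrite /= !inE !negb_or [u == x]eq_sym xu uv [u == y]eq_sym yu xv
       [x == y]eq_sym yx [v == y]eq_sym yv.
  - by move=> z; rewrite !inE => /or4P[]/eqP->.
  - by apply: dd => //; rewrite eq_sym.
move=> le1 le2; have {le1 le2} := leq_trans le1 le2.
have : m.+2 * (m.+1 * 'C(m.*2, m)) <= #|P| * (m.+1 * 'C(m.*2, m)).
  by rewrite leq_mul2r cP orbT.
move: 'C(_, _) #|bad_sets _ _ _ _| => c b le1 le2.
have {le1 le2} := leq_trans le1 le2; rewrite -mulnA leq_pmul2l // => le.
rewrite -(leq_pmul2l (ltn0Sn m)); nia.
Qed.

(** At least m+3 vertices of [S] are not adjacent to [v]; [u] is not among them, so only [v] itself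
    may be lost. *)
Lemma card_nonadjacent (V : finType) (G : sgraph V) (S : {set V}) m u v :
  #|S| = m.+2.*2 -> adj G u v -> degree G S v <= m.+1 ->
  m.+2 <= #|[set x in S :\: [set u; v] | ~~ adj G v x]|.
Proof.
move=> cS uv dv; set P := [set x in _ | _].
have : [set x in S | ~~ adj G v x] \subset v |: P.
  apply/subsetP => x; rewrite !inE => /andP[xS vx]; rewrite vx xS !andbT.
  by case: (eqVneq x v) => //= _; rewrite orbF; apply: contraNneq vx => ->; rewrite adjC.
move/subset_leq_card; rewrite cardsU1; move: dv; rewrite /degree.
have := cardsID [set x | adj G v x] S; rewrite cS.
rewrite (_ : S :&: _ = [set x in S | adj G v x]); last by apply/setP => x; rewrite !inE.
rewrite (_ : S :\: _ = [set x in S | ~~ adj G v x]); last first.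
  by apply/setP => x; rewrite !inE andbC.
by case: (v \in P); lia.
Qed.

Lemma card_adjacent (V : finType) (G : sgraph V) (S : {set V}) u v :
  ~~ adj G u v -> degree G S v <= #|[set x in S :\: [set u; v] | adj G v x]|.
Proof.
move=> uv; apply/subset_leq_card/subsetP => x; rewrite !inE => /andP[-> vx].
rewrite vx !andbT negb_or; apply/andP; split; apply: contraTneq vx => ->.
  by rewrite adjC.
by rewrite adjxx.
Qed.

Lemma exists_edge_nonedge (V : finType) (G : sgraph V) (A : {set V}) :
  0 < induced_edges G A < 'C(#|A|, 2) ->
  (exists u v, [/\ u \in A, v \in A & adj G u v]) /\
  (exists u v, [/\ u \in A, v \in A, u != v & ~~ adj G u v]).
Proof.
rewrite /induced_edges => /andP[/card_gt0P[e]]; rewrite inE => /andP[eG eA] lt.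
split.
  have /eqP/cards2P[a [b [_ ee]]] := card_edge eG.
  by move: eA eG; rewrite ee subUset !sub1set => /andP[aA bA]; exists a, b.
move: lt; rewrite -cards_draws => lt.
have /subsetPn[f] : ~~ ([set f : {set V} | f \subset A & #|f| == 2]
                          \subset [set f in edges G | f \subset A]).
  by apply: contraL lt => /subset_leq_card; rewrite -leqNgt.
rewrite !inE => /andP[fA /cards2P[a [b [ab fE]]]]; rewrite fA andbT fE => nadj.
by move: fA; rewrite fE subUset !sub1set => /andP[aA bA]; exists a, b.
Qed.

(** The constant is 32 = 4 * 4 * 2: two steps between central binomials, and the factor 2 of
    [card_bad_adj_sum]. *)
Lemma card_bad_sets_ge (V : finType) (G : sgraph V) (S : {set V}) k l :
  0 < l < 'C(k, 2) -> #|S| = k.*2 ->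
  'C(k.*2, k) <= 32 * #|bad_sets G S k l|.
Proof.
case: k => [|[|m]] lk cS; try by move: lk; rewrite bin_small // ltn0 andbF.
have st1 := bin_central_step m.+1; have st2 := bin_central_step m.
have [few|] := ltnP (2 * #|bad_sets G S m.+2 l|) 'C(m.+1.*2, m.+1); last by lia.
(* A good set spans neither 0 nor all possible edges, so it supplies an edge and a non-edge; without
   any good set, all k-subsets of [S] are bad. *)
have [|none] := boolP [exists A : {set V},
    [&& A \subset S, #|A| == m.+2 & induced_edges G A == l]]; last first.
  suff : 'C(m.+2.*2, m.+2) <= #|bad_sets G S m.+2 l| by lia.
  rewrite -cS -cards_draws; apply/subset_leq_card/subsetP => A.
  rewrite !inE => /andP[AS cA]; rewrite AS cA /=.
  by move/existsPn: none => /(_ A); rewrite AS cA.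
move=> /existsP[A /and3P[AS /eqP cA /eqP eA]].
have reg := degree_constant cS few.
suff : 'C(m.*2, m) <= 2 * #|bad_sets G S m.+2 l| by lia.
have [] := @exists_edge_nonedge _ G A; first by rewrite eA cA.
move=> [u [v [uA vA uv]]] [x [y [xA yA xy nxy]]].
have AinS z : z \in A -> z \in S by apply: subsetP.
have [small|big] := leqP (degree G S u) m.+1.
  (* Around the edge [u v] the left side is at least 1 and the right side is 0. *)
  apply: (@card_bad_adj_sum _ G S [set z in S :\: [set u; v] | ~~ adj G v z]
    [set z in S :\: [set u; v] | ~~ adj G u z] m l u v) => //; rewrite ?AinS //.
  - by apply: contraTneq uv => ->; rewrite adjxx.
  - by apply/subsetP => z; rewrite inE => /andP[].
  - by apply/subsetP => z; rewrite inE => /andP[].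
  - by apply: card_nonadjacent => //; rewrite (reg v u) ?AinS.
  - by rewrite setUC; apply: card_nonadjacent => //; rewrite adjC.
  move=> a b; rewrite !inE => /andP[_ va] /andP[_ ub] _.
  by rewrite uv (negPf ub) [adj G a v]adjC (negPf va).
(* Around the non-edge [x y] the left side is at most 1 and the right side is 2. *)
apply: (@card_bad_adj_sum _ G S [set z in S :\: [set x; y] | adj G y z]
    [set z in S :\: [set x; y] | adj G x z] m l x y) => //; rewrite ?AinS //.
- by apply/subsetP => z; rewrite inE => /andP[].
- by apply/subsetP => z; rewrite inE => /andP[].
- apply: leq_trans (card_adjacent S nxy).
  by rewrite (reg y u) ?AinS.
- rewrite setUC; apply: (@leq_trans (degree G S x)); first by rewrite (reg x u) ?AinS.
  by apply: card_adjacent; rewrite adjC.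
move=> a b; rewrite !inE => /andP[_ ya] /andP[_ xb] _.
by rewrite xb (negPf nxy) [adj G a y]adjC ya; case: adj.
Qed.

(** * Averaging over the 2k-subsets of the vertex set *)

Lemma card_supersets (V : finType) (A : {set V}) k j : #|A| = k ->
  #|[set S : {set V} | #|S| == k + j & A \subset S]| = 'C(#|V| - k, j).
Proof.
move=> cA; have -> : #|V| - k = #|~: A| by rewrite -(cardsC A) cA addKn.
rewrite -cards_draws -(card_in_imset (f := fun S => S :\: A)); last first.
  move=> S T; rewrite !inE => /andP[_ AS] /andP[_ AT] ST.
  by rewrite -(setID S A) -(setID T A) ST (setIidPr AS) (setIidPr AT).
apply: eq_card => B; rewrite inE; apply/imsetP/andP => [[S]|[BA /eqP cB]].
  rewrite inE => /andP[/eqP cS AS] ->; rewrite setDE subsetIr; split=> //.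
  by have := cardsID A S; rewrite (setIidPr AS) cS cA -setDE => /addnI ->.
have AB : [disjoint A & B] by rewrite disjoint_sym disjoints_subset.
exists (A :|: B); last first.
  by rewrite setDUl setDv set0U; apply/esym/setDidPl; rewrite disjoint_sym.
by rewrite inE subsetUl andbT; move: AB; rewrite -leq_card_setU => /eqP ->; rewrite cA cB.
Qed.

Lemma sum_card_subsets (V : finType) (F : {set {set V}}) k j :
  {in F, forall A : {set V}, #|A| = k} ->
  \sum_(S in ksubsets V (k + j)) #|[set A in F | A \subset S]|
    = #|F| * 'C(#|V| - k, j).
Proof.
move=> cF; under eq_bigr do rewrite card_set_sum.
rewrite exchange_big -sum_nat_const; apply: eq_bigr => A /cF cA /=.
rewrite -(card_supersets j cA) -card_set_sum; apply: eq_card => S.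
by rewrite !inE.
Qed.

(** Every k-set lies in the same positive number of 2k-sets [S], so the bound inside each [S] sums
    to the bound for the whole graph. *)
Lemma card_bad_ksubsets_ge (V : finType) (G : sgraph V) k l :
  0 < l < 'C(k, 2) -> k.*2 <= #|V| ->
  #|ksubsets V k| <= 32 * #|[set A in ksubsets V k | induced_edges G A != l]|.
Proof.
move=> lk kV; set B := [set A in _ | _].
have pos : 0 < 'C(#|V| - k, k) by rewrite bin_gt0; lia.
rewrite -(leq_pmul2r pos) -mulnA -!sum_card_subsets; first last.
- by move=> A; rewrite inE => /eqP.
- by move=> A; rewrite !inE => /andP[/eqP].
rewrite big_distrr /=; apply: leq_sum => S; rewrite inE addnn => /eqP cS.
rewrite (_ : [set A in B | A \subset S] = bad_sets G S k l); last first.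
  by apply/setP => A; rewrite !inE andbC.
apply: leq_trans (card_bad_sets_ge G lk cS); rewrite -cS -cards_draws.
by apply/eq_leq/eq_card => A; rewrite !inE andbC.
Qed.

(** * Probabilities and the limit *)

Local Open Scope ring_scope.

Lemma edge_prob_le (R : realType) (V : finType) (G : sgraph V) k l :
  (0 < l < 'C(k, 2))%N -> (k.*2 <= #|V|)%N -> edge_prob R G k l <= 31 / 32.
Proof.
move=> lk kV; have := card_bad_ksubsets_ge G lk kV; rewrite /edge_prob.
have := cardsID [set A | induced_edges G A == l] (ksubsets V k).
have -> : ksubsets V k :&: [set A | induced_edges G A == l]
    = [set A in ksubsets V k | induced_edges G A == l].
  by apply/setP => A; rewrite !inE.
have -> : ksubsets V k :\: [set A | induced_edges G A == l]
    = [set A in ksubsets V k | induced_edges G A != l].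
  by apply/setP => A; rewrite !inE andbC.
have : (0 < #|ksubsets V k|)%N by rewrite card_draws bin_gt0; lia.
set g := #|[set A in _ | _ == l]|; set b := #|[set A in _ | _ != l]|.
move: #|ksubsets V k| g b => t g b t0 gb tb.
rewrite ler_pdivrMr ?ltr0n // mulrAC ler_pdivlMr ?ltr0n // -!natrM ler_nat.
by lia.
Qed.

Lemma max_edge_prob_le (R : realType) n k l :
  (0 < l < 'C(k, 2))%N -> (k.*2 <= n)%N -> max_edge_prob R n k l <= 31 / 32.
Proof.
move=> lk kn; rewrite /max_edge_prob; elim/big_ind: _ => [|x y hx hy|G _].
- by rewrite divr_ge0.
- by rewrite ge_max hx.
by apply: edge_prob_le => //; rewrite card_ord.
Qed.

Theorem theorem1p3 (R : realType) :
  exists eps : R, 0 < eps /\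
    forall k l : nat, (0 < k)%N -> (0 < l)%N -> (l < 'C(k, 2))%N ->
      edge_inducibility R k l < 1 - eps.
Proof.
(* The limit inherits only the weak bound 31/32 = 1 - 1/32, so [eps] is taken slightly below 1/32 to
   make the inequality strict. *)
exists (1 / 33); split; first by rewrite divr_gt0.
move=> k l _ l0 lk; apply: (@le_lt_trans _ _ (31 / 32)); last by lra.
rewrite /edge_inducibility; set u := fun n => _.
(* The limit of a divergent sequence is the default value 0, so convergence need
   not be established. *)
have [cu|] := pselect (cvgn u); last by move/dvgP => ->; rewrite divr_ge0.
apply: limr_le => //; exists k.*2 => // n /= kn.
by apply: max_edge_prob_le; rewrite ?l0.
Qed.
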